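(* Let $S$ be a finite non-commutative completely $0$-simple semigroup. If the commuting graph $\mathcal{G}(S)$ contains cycles, then $\mathrm{girth}(\mathcal{G}(S))\in\{3,4\}$.
   Context: A semigroup $S$ with a zero $0$ is completely $0$-simple if it is $0$-simple (it is not a null semigroup and its only ideals are $\{0\}$ and $S$) and it contains a primitive idempotent (an idempotent that is minimal among the non-zero idempotents, in the natural partial order of idempotents). The commuting graph $\mathcal{G}(S)$ of a finite non-commutative semigroup $S$ is the simple graph with vertex set $S\setminus Z(S)$, where $Z(S)$ is the center of $S$, and where distinct vertices $x,y$ are adjacent iff $xy=yx$. The girth of a graph containing cycles is the length of a shortest cycle. *)

(* Defs.v *)
From HB Require Import structures.
From mathcomp Require Import all_boot.

Set Implicit Arguments.
Unset Strict Implicit.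
Unset Printing Implicit Defensive.

Local Open Scope group_scope.

#[short(type="finSemigroupType")]
HB.structure Definition FinSemigroup := {S of Semigroup S & Finite S}.

Section Semigroups.
Variable S : finSemigroupType.
Implicit Types (x y e f z : S) (I : {set S}).

Definition noncommutative_semigroup : Prop :=
  exists x y, x * y != y * x.

Definition center : {set S} := [set x | [forall y, x * y == y * x]].

Definition is_zero z : Prop := forall x, z * x = z /\ x * z = z.

Definition null_semigroup z : Prop := forall x y, x * y = z.

Definition is_ideal I : Prop :=
  I != set0 /\ forall x s, x \in I -> s * x \in I /\ x * s \in I.

Definition zero_simple z : Prop :=
  ~ null_semigroup z /\
  forall I, is_ideal I -> I = [set z] \/ I = [set: S].

Definition is_idempotent e : Prop := e * e = e.

(* Natural partial order, meant for idempotents e and f only *)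
Definition idem_le e f : Prop := e * f = e /\ f * e = e.

Definition primitive_idempotent z e : Prop :=
  [/\ is_idempotent e, e != z &
      forall f, is_idempotent f -> f != z -> idem_le f e -> f = e].

Definition completely_zero_simple z : Prop :=
  [/\ is_zero z, zero_simple z & exists e, primitive_idempotent z e].

End Semigroups.

Record sgraph : Type := SGraph {
  vertex :> finType;
  adj : rel vertex;
  adj_sym : symmetric adj;
  adj_irr : irreflexive adj
}.

(* [ucycle] also accepts the empty sequence and, for a symmetric relation,
   a single edge traversed back and forth, hence the bound on the length *)
Definition has_cycle_of_length (G : sgraph) (n : nat) : bool :=
  (2 < n) && [exists c : n.-tuple G, ucycleb (@adj G) c].

Definition contains_cycles (G : sgraph) : Prop :=
  exists n, has_cycle_of_length G n.

Definition girth (G : sgraph) (cG : contains_cycles G) : nat := ex_minn cG.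

Section CommutingGraph.
Variable S : finSemigroupType.

Definition commuting_vertex : finType := {x : S | x \notin center S}.

Definition commuting_adj : rel commuting_vertex :=
  fun x y => (x != y) && (val x * val y == val y * val x).

Lemma commuting_adj_sym : symmetric commuting_adj.
Proof. by move=> x y; rewrite /commuting_adj eq_sym [_ * _ == _]eq_sym. Qed.

Lemma commuting_adj_irr : irreflexive commuting_adj.
Proof. by move=> x; rewrite /commuting_adj eqxx. Qed.

Definition commuting_graph : sgraph :=
  SGraph commuting_adj_sym commuting_adj_irr.

End CommutingGraph.

(* Main.v *)
Require Import Defs.
From mathcomp Require Import all_boot.

(** Every vertex of a cycle has two neighbours on that cycle, and nothing else
    about the cycle is used.

    If adjacent x and y on it have x y <> 0, then x H y.  When all its edges are
    of this kind they lie in group H-classes: such a class, with identity e,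
    contains a triangle {e, a, b} if e is not central, and if e is central then
    for a path u - v - w one of {u, v, uv}, {v, w, vw}, {u, v, w} is a triangle.

    If some edge has v u = 0, then 0 is the only central element.  If H is not
    trivial, v and u have H-class mates v' and u', and v u v' u' is a 4-cycle
    (or v H u, and any further neighbour of u closes a triangle).  If H is
    trivial, the non-zero elements are the cells of a matrix whose rows are the
    L-classes, columns the R-classes, with a zero at (L_a, R_b) when a b = 0.
    Three zeros in a line give a triangle, two lines of the same direction with
    two zeros each give a 4-cycle; failing both, the degree condition forces
    all the vertices of the cycle into one cell. *)

Set Implicit Arguments.
Unset Strict Implicit.
Unset Printing Implicit Defensive.

(** * 0-simple semigroups as bare binary operations *)

Record zsimple (T : finType) (m : T -> T -> T) (z : T) : Prop := ZSimple {
  zsA : associative m;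
  zs0m : left_zero z m;
  zsm0 : right_zero z m;
  zs_gen : forall a x, a != z -> exists s t, x = m (m s a) t }.

(** The multiplication is a bare function so that a one-sided result, applied to [mop m], yields its
    left-right dual. *)
Definition mop (T : Type) (m : T -> T -> T) : T -> T -> T := fun x y => m y x.

Lemma zsimple_op (T : finType) (m : T -> T -> T) z :
  zsimple m z -> zsimple (mop m) z.
Proof.
case=> mA m0 m0' gen; split=> [x y w|//|//|a x aN0]; first by rewrite /mop mA.
by have [s [t ->]] := gen a x aN0; exists t, s; rewrite /mop mA.
Qed.

(* S^1 is not needed here: a \in a S in a 0-simple finite semigroup. *)
Definition greenR (T : finType) (m : T -> T -> T) : rel T :=
  fun a b => [set m a x | x : T] == [set m b x | x : T].

(** * Green's relation R *)

Section GreenRight.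
Variables (T : finType) (m : T -> T -> T) (z : T).
Hypothesis Sz : zsimple m z.
Local Notation "x * y" := (m x y).
Local Notation R := (greenR m).

Let mA := zsA Sz.
Let m0 := zs0m Sz.
Let m0' := zsm0 Sz.

Lemma greenR_refl a : R a a. Proof. exact: eqxx. Qed.

Lemma greenR_sym a b : R a b = R b a. Proof. exact: eq_sym. Qed.

Lemma greenR_trans a b c : R a b -> R b c -> R a c.
Proof. by rewrite /greenR => /eqP->. Qed.

(* Left multiplication by s maps ab S^1 onto a set containing a S^1, which by
   finiteness forces ab S^1 = a S^1. *)
Lemma zsimple_stable a b : a * b != z -> exists t, a = a * b * t.
Proof.
move=> abN0; have [s [t def_a]] := zs_gen Sz a abN0.
pose ideal1 c := c |: [set c * x | x : T].
have ideal1M c x : c * x \in ideal1 c by apply/setU1P; right; apply/imsetP; exists x.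
have sub : ideal1 (a * b) \subset ideal1 a.
  by apply/subsetP=> y /setU1P[->|/imsetP[x _ ->]]; rewrite -?mA ideal1M.
have le : #|ideal1 a| <= #|ideal1 (a * b)|.
  apply: leq_trans (leq_imset_card (m s) _).
  apply: subset_leq_card; apply/subsetP=> y /setU1P[->|/imsetP[x _ ->]].
    by rewrite {1}def_a -mA; apply: imset_f.
  by rewrite {1}def_a -(mA s) -(mA s); apply: imset_f; rewrite -(mA (a * b)).
have /eqP eq_id : ideal1 (a * b) == ideal1 a by rewrite eqEcard sub le.
have : a \in ideal1 (a * b) by rewrite eq_id setU11.
case/setU1P=> [ab|/imsetP[x _ ax]]; last by exists x.
by exists b; rewrite -!ab.
Qed.

(** Write a = p a q and q = s b t: then a = p (a s b) t, so a s b = 0 would kill a. *)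
Lemma zsimple_prime a b : a != z -> b != z -> exists s, a * s * b != z.
Proof.
move=> aN0 bN0; have [p [q def_a]] := zs_gen Sz a aN0.
have [s [t def_q]] := zs_gen Sz q bN0; exists s.
apply: contraNneq aN0 => asb0; apply/eqP.
by rewrite def_a def_q !mA -(mA p a) -(mA p (a * s)) asb0 m0' m0.
Qed.

Lemma greenR_mul a b : a * b != z -> R (a * b) a.
Proof.
move=> abN0; have [t def_a] := zsimple_stable abN0.
rewrite /greenR eqEsubset; apply/andP; split; apply/subsetP=> y /imsetP[x _ ->].
  by rewrite -mA imset_f.
by rewrite {1}def_a -mA imset_f.
Qed.

(** Primeness gives s with a s a nonzero, and stability then puts a in aS = bS. *)
Lemma greenR_mem a b : a != z -> R a b -> exists t, a = b * t.
Proof.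
move=> aN0 /eqP Rab; have [s asaN0] := zsimple_prime aN0 aN0.
have [|t def_a] := @zsimple_stable a (s * a); first by rewrite mA.
have : a \in [set a * x | x : T] by rewrite {1}def_a -mA imset_f.
by rewrite Rab => /imsetP[x _ ->]; exists x.
Qed.

Lemma greenR_zero a b b' : R b b' -> a * b = z -> a * b' = z.
Proof.
move=> Rbb' ab0; have [->//|b'N0] := eqVneq b' z.
rewrite greenR_sym in Rbb'; have [t ->] := greenR_mem b'N0 Rbb'.
by rewrite mA ab0.
Qed.

End GreenRight.

Definition greenL (T : finType) (m : T -> T -> T) : rel T := greenR (mop m).

Definition greenH (T : finType) (m : T -> T -> T) : rel T :=
  fun a b => greenR m a b && greenL m a b.

(** * Short cycles and the graph of zero products *)

Definition short_cycle (T : finType) (e : rel T) : bool :=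
  [exists c : 3.-tuple T, ucycleb e c] || [exists c : 4.-tuple T, ucycleb e c].

Lemma triangle_short (T : finType) (e : rel T) a b c :
  irreflexive e -> e a b -> e b c -> e c a -> short_cycle e.
Proof.
move=> eI ab bc ca; apply/orP; left; apply/existsP; exists [tuple a; b; c].
have ne x y : e x y -> x != y by apply: contraTneq => ->; rewrite eI.
rewrite /ucycleb /= ab bc ca !inE /= negb_or (ne _ _ ab) (ne _ _ bc).
by rewrite eq_sym (ne _ _ ca).
Qed.

Lemma square_short (T : finType) (e : rel T) a b c d :
  irreflexive e -> e a b -> e b c -> e c d -> e d a ->
  a != c -> b != d -> short_cycle e.
Proof.
move=> eI ab bc cd da ac bd; apply/orP; right; apply/existsP.
exists [tuple a; b; c; d].
have ne x y : e x y -> x != y by apply: contraTneq => ->; rewrite eI.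
rewrite /ucycleb /= ab bc cd da !inE /= !negb_or ac bd (ne _ _ ab) (ne _ _ bc).
by rewrite (ne _ _ cd) eq_sym (ne _ _ da).
Qed.

Lemma sub_short_cycle (T : finType) (e e' : rel T) :
  subrel e e' -> short_cycle e -> short_cycle e'.
Proof.
move=> ee' /orP[]/existsP[c /andP[cyc_c uniq_c]]; apply/orP; [left|right];
  by apply/existsP; exists c; rewrite /ucycleb uniq_c (sub_cycle ee').
Qed.

Definition min_degree2 (T : finType) (e : rel T) (C : {pred T}) : Prop :=
  forall v, v \in C -> exists u w,
    [/\ u \in C, w \in C, u != w, e v u & e v w].

Definition null_adj (T : finType) (m : T -> T -> T) (z : T) : rel T :=
  fun x y => [&& x != z, y != z, x != y, m x y == z & m y x == z].

(** In the matrix of zero products, the row of the L-class of a has zeros in two different columns.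
    With [mop m] this speaks of the column of the R-class of a. *)
Definition two_zeros (T : finType) (m : T -> T -> T) (z a : T) : bool :=
  [exists b, exists c,
    [&& b != z, c != z, m a b == z, m a c == z & ~~ greenR m b c]].

Lemma null_adj_irr (T : finType) (m : T -> T -> T) z : irreflexive (null_adj m z).
Proof. by move=> x; rewrite /null_adj eqxx /= !andbF. Qed.

Lemma null_adj_sym (T : finType) (m : T -> T -> T) z : symmetric (null_adj m z).
Proof.
by move=> x y; apply/and5P/and5P=> -[]; rewrite eq_sym; split=> //; rewrite eq_sym.
Qed.

Lemma null_adj_op (T : finType) (m : T -> T -> T) z :
  null_adj (mop m) z =2 null_adj m z.
Proof. by move=> x y; rewrite /null_adj /mop (andbC (m y x == z)). Qed.

(** * Interplay of R, L and H *)

Section Green.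
Variables (T : finType) (m : T -> T -> T) (z : T).
Hypothesis Sz : zsimple m z.
Local Notation "x * y" := (m x y).
Local Notation R := (greenR m).
Local Notation L := (greenL m).
Local Notation H := (greenH m).
Let Sz' := zsimple_op Sz.
Let mA := zsA Sz.
Let m0 := zs0m Sz.
Let m0' := zsm0 Sz.

Lemma greenL_mul a b : a * b != z -> L (a * b) b.
Proof. exact: (greenR_mul Sz'). Qed.

Lemma greenL_mem a b : a != z -> L a b -> exists t, a = t * b.
Proof. exact: (greenR_mem Sz'). Qed.

Lemma greenL_zero a a' b : L a a' -> a * b = z -> a' * b = z.
Proof. exact: (greenR_zero Sz'). Qed.

(** This makes the zero matrix well defined: whether a product vanishes depends only on the L-class
    of its left factor and the R-class of its right factor. *)
Lemma greenLR_zero a b a' b' : L a a' -> R b b' -> a * b = z -> a' * b' = z.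
Proof. by move=> Laa' Rbb' /(greenL_zero Laa')/(greenR_zero Sz Rbb'). Qed.

(** No cell of the matrix is empty: a nonzero product a s b lies in the R-class of a and the L-class
    of b. *)
Lemma greenR_L_meet a b : a != z -> b != z ->
  exists c, [/\ c != z, R c a & L c b].
Proof.
move=> aN0 bN0; have [s asbN0] := zsimple_prime Sz aN0 bN0; exists (a * s * b).
by split; [|rewrite -mA (greenR_mul Sz) // mA|exact: greenL_mul].
Qed.

Lemma greenH_refl a : H a a.
Proof. by rewrite /greenH /greenL !greenR_refl. Qed.

Lemma greenH_sym a b : H a b = H b a.
Proof. by rewrite /greenH /greenL !(greenR_sym _ b). Qed.

Lemma greenH_neq0 a b : H a b -> a != z -> b != z.
Proof.
rewrite greenH_sym => /andP[Rba _]; apply: contraNneq => b0.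
apply/eqP; have [//|aN0] := eqVneq a z.
by rewrite greenR_sym in Rba; have [t ->] := greenR_mem Sz aN0 Rba; rewrite b0 m0.
Qed.

(** A nonzero product is R-related to its left factor and L-related to its right one; here each
    factor plays both roles. *)
Lemma commute_greenH a b : a * b = b * a -> a * b != z -> H a b.
Proof.
move=> cab abN0; have baN0 : b * a != z by rewrite -cab.
apply/andP; split.
  apply: (greenR_trans _ (greenR_mul Sz baN0)).
  by rewrite greenR_sym -cab; exact: (greenR_mul Sz abN0).
apply: (greenR_trans _ (greenL_mul abN0)).
by rewrite greenR_sym cab; apply: greenL_mul.
Qed.

(** For x nonzero, some c s x = s c x is nonzero, hence so is c x, and x H c. Then x y = 0 would
    force c y = 0. *)
Lemma central_no_zero_divisors c : c != z -> (forall x, c * x = x * c) ->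
  forall x y, x != z -> y != z -> x * y != z.
Proof.
move=> cN0 cC.
have cx x : x != z -> c * x != z.
  move=> xN0; have [s] := zsimple_prime Sz cN0 xN0; rewrite cC -mA.
  by apply: contraNneq => ->; rewrite m0'.
have cH x : x != z -> H x c.
  by move=> xN0; rewrite greenH_sym; apply: commute_greenH; [exact: cC|exact: cx].
move=> x y xN0 yN0; apply/eqP=> xy0.
have /andP[_ Lxc] := cH x xN0.
by have := cx y yN0; rewrite (greenL_zero Lxc xy0) eqxx.
Qed.

(* A translation by u on the left that does not kill a is injective on the
   R-class of a. *)
Lemma mul_injR u a a' : u * a != z -> R a a' -> u * a = u * a' -> a = a'.
Proof.
move=> uaN0 Raa' eq_ua.
have [t def_a] : exists t, a = t * (u * a).
  by have [t ta] := zsimple_stable Sz' uaN0; exists t.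
have [a'0|a'N0] := eqVneq a' z; first by rewrite eq_ua a'0 m0' eqxx in uaN0.
have [v def_a'] : exists v, a' = a * v.
  by apply: (greenR_mem Sz a'N0); rewrite greenR_sym.
by rewrite {1}def_a eq_ua def_a' [u * _]mA [t * _]mA -def_a.
Qed.
End Green.

(** * H-classes and zeros that force short cycles *)

Section ZeroPattern.
Variables (T : finType) (m : T -> T -> T) (z : T).
Hypothesis Sz : zsimple m z.
Local Notation "x * y" := (m x y).
Local Notation R := (greenR m).
Local Notation L := (greenL m).
Local Notation H := (greenH m).
Let Sz' := zsimple_op Sz.
Let mA := zsA Sz.

Lemma mul_injL u a a' : a * u != z -> L a a' -> a * u = a' * u -> a = a'.
Proof. exact: (mul_injR Sz'). Qed.

(** Green's lemma: for suitable s and t, the map x -> b s x t b is injective from the H-class of a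
    to that of b. *)
Lemma greenH_transfer a a' b : a != z -> b != z -> H a a' -> a' != a ->
  exists2 b', H b b' & b' != b.
Proof.
move=> aN0 bN0 Haa' a'Na; have a'N0 := greenH_neq0 Sz Haa' aN0.
have /andP[Raa' Laa'] := Haa'.
have [s bsaN0] := zsimple_prime Sz bN0 aN0.
have [t] := zsimple_prime Sz bsaN0 bN0; rewrite -mA => bsatbN0.
have Hb x : b * s * x * (t * b) != z -> H b (b * s * x * (t * b)).
  move=> nz; rewrite greenH_sym; apply/andP; split.
    by rewrite -!mA (greenR_mul Sz) // !mA -mA.
  by rewrite mA (greenL_mul Sz) // -mA.
have bsa'N0 : b * s * a' != z.
  apply: contraNneq bsaN0 => bsa'0; apply/eqP.
  by apply: (greenR_zero Sz _ bsa'0); rewrite greenR_sym.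
have Lbs : L (b * s * a) (b * s * a').
  apply: greenR_trans (greenL_mul Sz bsaN0) _; apply: greenR_trans Laa' _.
  by rewrite greenR_sym; apply: (greenL_mul Sz).
have bsa'tbN0 : b * s * a' * (t * b) != z.
  apply: contraNneq bsatbN0 => bsa'tb0; apply/eqP.
  by apply: (greenL_zero Sz _ bsa'tb0); rewrite /greenL greenR_sym.
(* Either the image of a already differs from b, or it is b and injectivity makes the image of a'
   differ from b. *)
have [eqb|] := eqVneq (b * s * a * (t * b)) b; last by exists (b * s * a * (t * b)); auto.
exists (b * s * a' * (t * b)); first exact: Hb.
rewrite -[X in _ != X]eqb; apply: contraNneq a'Na => eq2.
apply/eqP/esym/(mul_injR Sz bsaN0 Raa').
exact: (mul_injL bsatbN0 Lbs (esym eq2)).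
Qed.

Lemma two_zerosP a :
  reflect (exists b c, [/\ b != z, c != z, a * b = z, a * c = z & ~~ R b c])
          (two_zeros m z a).
Proof.
apply: (iffP existsP) => [[b /existsP[c /and5P[? ? /eqP ? /eqP ? ?]]]|].
  by exists b, c.
move=> [b [c [bN0 cN0 ab ac nR]]]; exists b; apply/existsP; exists c.
by rewrite bN0 cN0 ab ac !eqxx nR.
Qed.

(** With x in cell (L_a, R_c) and y in cell (L_a', R_b), the product x y is governed by the entry
    (L_a, R_b) and y x by (L_a', R_c). *)
Lemma row_zeros_adj a a' b c x y : a * b = z -> a' * c = z ->
  R x c -> L x a -> R y b -> L y a' -> x != z -> y != z -> x != y ->
  null_adj m z x y.
Proof.
move=> ab a'c Rxc Lxa Ryb Lya' xN0 yN0 xNy; apply/and5P; split=> //; apply/eqP.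
  apply: (greenLR_zero Sz _ _ ab); first by rewrite /greenL greenR_sym.
  by rewrite greenR_sym.
apply: (greenLR_zero Sz _ _ a'c); first by rewrite /greenL greenR_sym.
by rewrite greenR_sym.
Qed.

(** Choose x_i in the cell (L_a, R_{b_i}): every x_i x_j vanishes because a b_j does. *)
Lemma three_zeros_short a b1 b2 b3 :
  a != z -> b1 != z -> b2 != z -> b3 != z ->
  a * b1 = z -> a * b2 = z -> a * b3 = z ->
  ~~ R b1 b2 -> ~~ R b2 b3 -> ~~ R b3 b1 -> short_cycle (null_adj m z).
Proof.
move=> aN0 b1N0 b2N0 b3N0 ab1 ab2 ab3 n12 n23 n31.
have [x1 [x1N0 Rx1 Lx1]] := greenR_L_meet Sz b1N0 aN0.
have [x2 [x2N0 Rx2 Lx2]] := greenR_L_meet Sz b2N0 aN0.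
have [x3 [x3N0 Rx3 Lx3]] := greenR_L_meet Sz b3N0 aN0.
have ne x y b c : R x b -> R y c -> ~~ R b c -> x != y.
  move=> Rxb Ryc; apply: contraNneq => xy; apply: greenR_trans Ryc.
  by rewrite -xy greenR_sym.
apply: (@triangle_short _ _ x1 x2 x3 (null_adj_irr m z)).
- exact: (row_zeros_adj ab2 ab1 Rx1 Lx1 Rx2 Lx2 x1N0 x2N0 (ne _ _ _ _ Rx1 Rx2 n12)).
- exact: (row_zeros_adj ab3 ab2 Rx2 Lx2 Rx3 Lx3 x2N0 x3N0 (ne _ _ _ _ Rx2 Rx3 n23)).
- exact: (row_zeros_adj ab1 ab3 Rx3 Lx3 Rx1 Lx1 x3N0 x1N0 (ne _ _ _ _ Rx3 Rx1 n31)).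
Qed.

(** Cross the data: put x1, x2 in the row of a at the zero columns of a', and y1, y2 in the row of
    a' at the zero columns of a. Every x_i is then adjacent to every y_j. *)
Lemma two_rows_short a a' : a != z -> a' != z ->
  two_zeros m z a -> two_zeros m z a' -> ~~ L a a' ->
  short_cycle (null_adj m z).
Proof.
move=> aN0 a'N0 /two_zerosP[b1 [b2 [b1N0 b2N0 ab1 ab2 nRb]]].
move=> /two_zerosP[c1 [c2 [c1N0 c2N0 ac1 ac2 nRc]]] nL.
have [x1 [x1N0 Rx1 Lx1]] := greenR_L_meet Sz c1N0 aN0.
have [x2 [x2N0 Rx2 Lx2]] := greenR_L_meet Sz c2N0 aN0.
have [y1 [y1N0 Ry1 Ly1]] := greenR_L_meet Sz b1N0 a'N0.
have [y2 [y2N0 Ry2 Ly2]] := greenR_L_meet Sz b2N0 a'N0.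
have ne x y : L x a -> L y a' -> x != y.
  move=> Lxa Lya'; apply: contraNneq nL => xy; apply: greenR_trans Lya'.
  by rewrite -xy greenR_sym.
have neR x y b c : R x b -> R y c -> ~~ R b c -> x != y.
  move=> Rxb Ryc; apply: contraNneq => xy; apply: greenR_trans Ryc.
  by rewrite -xy greenR_sym.
apply: (@square_short _ _ x1 y1 x2 y2 (null_adj_irr m z)).
- exact: (row_zeros_adj ab1 ac1 Rx1 Lx1 Ry1 Ly1 x1N0 y1N0 (ne _ _ Lx1 Ly1)).
- rewrite null_adj_sym.
  exact: (row_zeros_adj ab1 ac2 Rx2 Lx2 Ry1 Ly1 x2N0 y1N0 (ne _ _ Lx2 Ly1)).
- exact: (row_zeros_adj ab2 ac2 Rx2 Lx2 Ry2 Ly2 x2N0 y2N0 (ne _ _ Lx2 Ly2)).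
- rewrite null_adj_sym.
  exact: (row_zeros_adj ab2 ac1 Rx1 Lx1 Ry2 Ly2 x1N0 y2N0 (ne _ _ Lx1 Ly2)).
- exact: neR Rx1 Rx2 nRc.
- exact: neR Ry1 Ry2 nRb.
Qed.
End ZeroPattern.

Lemma short_null_op (T : finType) (m : T -> T -> T) z :
  short_cycle (null_adj (mop m) z) = short_cycle (null_adj m z).
Proof.
by apply/idP/idP; apply: sub_short_cycle => x y; rewrite null_adj_op.
Qed.

(** * The zero matrix when H is trivial *)

Section TrivialH.
Variables (T : finType) (m : T -> T -> T) (z : T) (C : {pred T}).
Hypothesis Sz : zsimple m z.
Hypothesis H_trivial : forall a b, a != z -> greenH m a b -> a = b.
Hypothesis C_deg2 : min_degree2 (null_adj m z) C.

(** Two distinct neighbours of v are not H-related, so they differ in R, giving two zeros in the row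
    of v, or in L, giving two in its column. *)
Lemma two_zeros_row_or_col v :
  v \in C -> two_zeros m z v || two_zeros (mop m) z v.
Proof.
move=> /C_deg2[u [w [uC wC uNw /and5P[_ uN0 _ /eqP vu /eqP uv]]]].
move=> /and5P[_ wN0 _ /eqP vw /eqP wv].
have : ~~ greenH m u w by apply: contraNN uNw => /(H_trivial uN0)->.
rewrite negb_and => /orP[nR|nL]; apply/orP; [left|right].
  by apply/two_zerosP; exists u, w.
by apply/two_zerosP; exists u, w.
Qed.

Lemma two_zeros_row_col v : ~~ short_cycle (null_adj m z) ->
  v \in C -> two_zeros m z v -> two_zeros (mop m) z v.
Proof.
move=> no_short vC row_v; apply: contraT => ncol_v.
have [u [w [uC wC uNw]]] := C_deg2 vC.
move=> /and5P[vN0 uN0 vNu /eqP vu /eqP uv] /and5P[_ wN0 vNw /eqP vw /eqP wv].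
(* The neighbours u and w both annihilate v from the left, so different L-classes would give the
   column of v two zeros. *)
have Luw : greenL m u w.
  by apply: contraNT ncol_v => nL; apply/two_zerosP; exists u, w.
have nRuw : ~~ greenR m u w.
  by apply: contraNN uNw => Ruw; rewrite (H_trivial uN0 (b := w)) // /greenH Ruw.
(* If u and w lie outside the row of v, then either one of their rows has two zeros, as that of v
   does, or both their columns have two; these are distinct parallel lines either way. *)
have Luv : greenL m u v.
  apply: contraNT no_short => nLuv.
  have [row_u|nrow_u] := boolP (two_zeros m z u).
    exact: (two_rows_short Sz uN0 vN0 row_u row_v nLuv).
  have [row_w|nrow_w] := boolP (two_zeros m z w).
    apply: (two_rows_short Sz wN0 vN0 row_w row_v).
    by apply: contraNN nLuv; apply: greenR_trans Luw.
  have := two_zeros_row_or_col uC; rewrite (negPf nrow_u) /= => col_u.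
  have := two_zeros_row_or_col wC; rewrite (negPf nrow_w) /= => col_w.
  by rewrite -short_null_op (two_rows_short (zsimple_op Sz) uN0 wN0 col_u col_w).
have Lwv : greenL m w v by apply: greenR_trans Luv; rewrite greenR_sym.
have nR x : x != z -> v != x -> greenL m x v -> ~~ greenR m x v.
  move=> xN0 vNx Lxv; apply: contraNN vNx => Rxv.
  by rewrite (H_trivial xN0 (b := v)) // /greenH Rxv.
(* Since u L v and u v = 0, also v v = 0: the row of v has zeros in the columns of u, w and v
   itself. *)
case/negP: no_short; apply: (three_zeros_short Sz vN0 uN0 wN0 vN0) => //.
- exact: (greenL_zero Sz Luv uv).
- exact: nR.
- by rewrite greenR_sym nR.
Qed.

End TrivialH.

(** Without short cycles, the row and the column of each vertex in [C] have two zeros. Adjacent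
    vertices then share both row and column, hence are equal, a contradiction. *)
Lemma trivialH_short (T : finType) (m : T -> T -> T) (z : T) (C : {pred T}) v :
  zsimple m z -> (forall a b, a != z -> greenH m a b -> a = b) ->
  min_degree2 (null_adj m z) C -> v \in C -> short_cycle (null_adj m z).
Proof.
move=> Sz trivH C2 vC; apply: contraT => no_short.
have row_col x : x \in C -> two_zeros m z x /\ two_zeros (mop m) z x.
  move=> xC; have /orP[row_x|col_x] := two_zeros_row_or_col trivH C2 xC.
    by split=> //; exact: (two_zeros_row_col Sz trivH C2 no_short xC row_x).
  split=> //.
  apply: (two_zeros_row_col (C := C) (zsimple_op Sz)) => // [a b aN0||].
  - by rewrite /greenH andbC; apply: trivH.
  - by move=> y /C2[u [w [? ? ? ? ?]]]; exists u, w; rewrite !(null_adj_op m z).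
  - by rewrite short_null_op.
have [u [_ [uC _ _ /and5P[vN0 uN0 vNu _ _] _]]] := C2 v vC.
have [[row_v col_v] [row_u col_u]] := (row_col v vC, row_col u uC).
case/negP: vNu; apply/eqP/trivH => //; apply/andP; split.
  apply: contraNT no_short; rewrite -short_null_op.
  exact: (two_rows_short (zsimple_op Sz) _ _ col_v col_u).
by apply: contraNT no_short; apply: (two_rows_short Sz _ _ row_v row_u).
Qed.

(** * Cycles in the commuting graph *)

Definition noncentral (T : finType) (m : T -> T -> T) (x : T) : bool :=
  [exists y, m x y != m y x].

(** The commuting graph spread over all of [T], with the central elements as isolated vertices. *)
Definition comm_adj (T : finType) (m : T -> T -> T) : rel T :=
  fun x y => [&& noncentral m x, noncentral m y, x != y & m x y == m y x].

Section CommutingCycles.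
Variables (T : finType) (m : T -> T -> T) (z : T) (C : {pred T}).
Hypothesis Sz : zsimple m z.
Hypothesis C_deg2 : min_degree2 (comm_adj m) C.
Local Notation "x * y" := (m x y).
Local Notation H := (greenH m).
Let mA := zsA Sz.
Let m0 := zs0m Sz.
Let m0' := zsm0 Sz.

Lemma comm_adj_irr : irreflexive (comm_adj m).
Proof. by move=> x; rewrite /comm_adj eqxx !andbF. Qed.

Lemma comm_adj_sym : symmetric (comm_adj m).
Proof.
by move=> x y; apply/and4P/and4P=> -[]; rewrite eq_sym; split=> //; rewrite eq_sym.
Qed.

Lemma centralP x : reflect (forall y, x * y = y * x) (~~ noncentral m x).
Proof.
by rewrite negb_exists; apply: (iffP forallP) => cx y; have:= cx y;
  rewrite negbK => /eqP.
Qed.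

Lemma noncentral_neq0 x : noncentral m x -> x != z.
Proof.
by apply: contraTneq => ->; apply/centralP => y; rewrite m0 m0'.
Qed.

Lemma null_edge_short v u : v \in C -> u \in C -> comm_adj m v u ->
  v * u = z -> short_cycle (comm_adj m).
Proof.
move=> vC uC /and4P[v_nc u_nc vNu /eqP cvu] vu.
have [vN0 uN0] := (noncentral_neq0 v_nc, noncentral_neq0 u_nc).
have uv : u * v = z by rewrite -cvu.
(* Since v u = 0 gives zero divisors, no nonzero element is central, and the graph of zero products
   is a subgraph of the commuting graph. *)
have nc x : x != z -> noncentral m x.
  move=> xN0; apply: contraT => /centralP cx.
  by have := central_no_zero_divisors Sz xN0 cx vN0 uN0; rewrite vu eqxx.
have sub : subrel (null_adj m z) (comm_adj m).
  move=> x y /and5P[xN0 yN0 xNy /eqP xy /eqP yx].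
  by rewrite /comm_adj !nc // xNy xy yx eqxx.
have nullI x y : x != z -> y != z -> x != y -> x * y = z -> y * x = z ->
  null_adj m z x y.
  by rewrite /null_adj => -> -> -> -> ->; rewrite eqxx.
have [Hvu|nHvu] := boolP (H v u).
  have [w [wC wNv uw]] : exists w, [/\ w \in C, w != v & comm_adj m u w].
    have [p [q [pC qC pNq up uq]]] := C_deg2 uC.
    have [pv|pNv] := eqVneq p v; last by exists p.
    by exists q; rewrite -pv eq_sym.
  have /andP[Rvu Lvu] := Hvu.
  have uu : u * u = z by apply: (greenL_zero Sz Lvu vu).
  have /and4P[_ w_nc uNw /eqP cuw] := uw; have wN0 := noncentral_neq0 w_nc.
  (* Were u w nonzero, u H w would follow, and u u = 0 would give u w = 0. Then w annihilates v as
     well, since v H u. *)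
  have uw0 : u * w = z.
    apply/eqP; apply: contraT => uwN0.
    have /andP[Ruw _] := commute_greenH Sz cuw uwN0.
    by rewrite (greenR_zero Sz Ruw uu) eqxx in uwN0.
  have wu0 : w * u = z by rewrite -cuw.
  have Ruv : greenR m u v by rewrite greenR_sym.
  have Luv : greenL m u v by rewrite /greenL greenR_sym.
  apply: (sub_short_cycle sub).
  apply: (triangle_short (a := v) (b := u) (c := w) (null_adj_irr m z)).
  - exact: nullI.
  - exact: nullI.
  - by apply: nullI => //; [apply: (greenR_zero Sz Ruv wu0)|apply: (greenL_zero Sz Luv uw0)].
have [|] := boolP [exists a, exists a', [&& a != z, a' != a & H a a']].
  move=> /existsP[a /existsP[a' /and3P[aN0 a'Na Haa']]].
  have [v' Hv v'Nv] := greenH_transfer Sz aN0 vN0 Haa' a'Na.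
  have [u' Hu u'Nu] := greenH_transfer Sz aN0 uN0 Haa' a'Na.
  have [v'N0 u'N0] := (greenH_neq0 Sz Hv vN0, greenH_neq0 Sz Hu uN0).
  have [/andP[Rv Lv] /andP[Ru Lu]] := (Hv, Hu).
  have Htrans x y w : H x y -> H y w -> H x w.
    move=> /andP[Rxy Lxy] /andP[Ryw Lyw]; apply/andP.
    by split; [apply: greenR_trans Ryw|apply: greenR_trans Lyw].
  apply: (sub_short_cycle sub).
  apply: (square_short (a := v) (b := u) (c := v') (d := u') (null_adj_irr m z)).
  - exact: nullI.
  - apply: nullI => //; [|exact: (greenR_zero Sz Rv uv)|exact: (greenL_zero Sz Lv vu)].
    by apply: contraNneq nHvu => ->.
  - apply: nullI => //.
    + apply: contraNneq nHvu => v'u'; apply: Htrans Hv _.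
      by rewrite v'u' greenH_sym.
    + exact: (greenLR_zero Sz Lv Ru vu).
    + exact: (greenLR_zero Sz Lu Rv uv).
  - apply: nullI => //; [|exact: (greenL_zero Sz Lu uv)|exact: (greenR_zero Sz Ru vu)].
    by apply: contraNneq nHvu => <-; rewrite greenH_sym.
  - by rewrite eq_sym.
  - by rewrite eq_sym.
move=> noH; have trivH a b : a != z -> H a b -> a = b.
  move=> aN0 Hab; apply/eqP; apply: contraNT noH => aNb.
  by apply/existsP; exists a; apply/existsP; exists b; rewrite aN0 eq_sym aNb.
(* With H trivial, commuting elements with nonzero product coincide, so every edge is a zero
   edge. *)
have comm_null x y : comm_adj m x y -> null_adj m z x y.
  move=> /and4P[x_nc y_nc xNy /eqP cxy].
  have [xN0 yN0] := (noncentral_neq0 x_nc, noncentral_neq0 y_nc).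
  have xy : x * y = z.
    apply/eqP; apply: contraNT xNy => /(commute_greenH Sz cxy)/(trivH _ _ xN0)->.
    exact: eqxx.
  by apply: nullI; rewrite -?cxy.
apply: (sub_short_cycle sub); apply: (trivialH_short Sz trivH _ vC).
move=> x /C_deg2[p [q [pC qC pNq xp xq]]].
by exists p, q; split=> //; apply: comm_null.
Qed.

(** From b = b b t = t' b b comes b t = t' b, a two-sided identity for b. It fixes bS from the left
    and Sb from the right, hence the whole H-class. *)
Lemma greenH_identity b : b * b != z ->
  exists2 e, H b e & forall x, H b x -> e * x = x /\ x * e = x.
Proof.
move=> bbN0; have [t def_b] := zsimple_stable Sz bbN0.
have [t' def_b'] : exists t', b = t' * (b * b).
  by have [t' t'b] := zsimple_stable (zsimple_op Sz) bbN0; exists t'.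
have bt : b * t = t' * b by rewrite {1}def_b' -!mA [b * (b * t)]mA -def_b.
have be : b * (b * t) = b by rewrite mA -def_b.
have eb : b * t * b = b by rewrite bt -mA -def_b'.
have bN0 : b != z by apply: contraNneq bbN0 => ->; rewrite m0.
exists (b * t).
  apply: (commute_greenH Sz _ _); first by rewrite be eb.
  by rewrite be.
move=> x Hbx; have xN0 := greenH_neq0 Sz Hbx bN0.
have /andP[Rxb Lxb] : H x b by rewrite greenH_sym.
split; first by have [s ->] := greenR_mem Sz xN0 Rxb; rewrite mA eb.
by have [s ->] := greenL_mem Sz xN0 Lxb; rewrite -mA be.
Qed.

Lemma group_edges_short v : v \in C ->
  (forall x y, x \in C -> y \in C -> comm_adj m x y -> x * y != z) ->
  short_cycle (comm_adj m).
Proof.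
move=> vC nz.
have Hadj x y : x \in C -> y \in C -> comm_adj m x y -> H x y.
  move=> xC yC xy; have /and4P[_ _ _ /eqP cxy] := xy.
  exact: (commute_greenH Sz cxy (nz x y xC yC xy)).
have [u [w [uC wC uNw vu vw]]] := C_deg2 vC.
have /andP[Rvu _] := Hadj v u vC uC vu.
have vvN0 : v * v != z.
  by apply: contraNneq (nz v u vC uC vu) => vv; rewrite (greenR_zero Sz Rvu vv).
have [e Hve e_id] := greenH_identity vvN0.
have [e_nc|/centralP e_c] := boolP (noncentral m e).
  have e_adj x : x != e -> noncentral m x -> H v x -> comm_adj m e x.
    move=> xNe x_nc /e_id[ex xe].
    by rewrite /comm_adj e_nc x_nc eq_sym xNe ex xe eqxx.
  (* The identity e is adjacent to every other noncentral element of its H-class, so any edge there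
     avoiding e closes a triangle. *)
  have tri x y : x != e -> y != e -> H v x -> H v y -> comm_adj m x y ->
      short_cycle (comm_adj m).
    move=> xNe yNe Hx Hy xy; have /and4P[x_nc y_nc _ _] := xy.
    apply: (triangle_short comm_adj_irr (e_adj x xNe x_nc Hx) xy).
    by rewrite comm_adj_sym e_adj.
  have [ve|vNe] := eqVneq v e.
    have Hvu := Hadj v u vC uC vu.
    have [p [q [pC qC pNq up uq]]] := C_deg2 uC.
    have uNe : u != e by have /and4P[_ _ vNu _] := vu; rewrite -ve eq_sym.
    have Hv x : x \in C -> comm_adj m u x -> H v x.
      move=> xC /(Hadj u x uC xC)/andP[Rux Lux]; have /andP[Rvu' Lvu'] := Hvu.
      by rewrite /greenH (greenR_trans Rvu' Rux) /greenL (greenR_trans Lvu' Lux).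
    have [pe|pNe] := eqVneq p e; last exact: tri uNe pNe Hvu (Hv p pC up) up.
    have qNe : q != e by rewrite -pe eq_sym.
    exact: tri uNe qNe Hvu (Hv q qC uq) uq.
  have [ue|uNe] := eqVneq u e.
    have wNe : w != e by rewrite -ue eq_sym.
    apply: (tri v w) => //; [exact: greenH_refl|exact: Hadj].
  by apply: (tri v u) => //; [exact: greenH_refl|exact: Hadj].
have vN0 : v != z by apply: contraNneq vvN0 => ->; rewrite m0.
have nzd := central_no_zero_divisors Sz (greenH_neq0 Sz Hve vN0) e_c.
have vNe : v != e.
  by have /and4P[/existsP[y v_nc] _ _ _] := vu; apply: contraNneq v_nc => ->; rewrite e_c.
(* The triangle is v, x, xv: cancellation turns xv = x into v = e and xv = v into x = e, while e is
   central and v, x are not. *)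
have prod_central x : x \in C -> comm_adj m v x ->
    noncentral m (x * v) -> short_cycle (comm_adj m).
  move=> xC vx xv_nc; have /and4P[v_nc x_nc vNx /eqP cvx] := vx.
  have Hvx := Hadj v x vC xC vx.
  have /andP[Rvx Lvx] := Hvx; have /andP[Rve Lve] := Hve.
  have xNe : x != e.
    by have /existsP[y x_y] := x_nc; apply: contraNneq x_y => ->; rewrite e_c.
  have xN0 := noncentral_neq0 x_nc.
  have [ex xe] := e_id x Hvx; have [ev ve] := e_id v (greenH_refl m v).
  apply: (triangle_short (a := v) (b := x) (c := x * v) comm_adj_irr vx).
    rewrite /comm_adj x_nc xv_nc -{2}cvx mA eqxx andbT /=.
    apply: contraNneq vNe => x_xv; apply/eqP.
    by apply: (mul_injR Sz (u := x) (nzd x v xN0 vN0) Rve); rewrite xe -x_xv.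
  rewrite /comm_adj xv_nc v_nc [v * _]mA cvx eqxx andbT /=.
  apply: contraNneq xNe => xv_v; apply/eqP.
  apply: (mul_injL Sz (u := v) (nzd x v xN0 vN0)); last by rewrite ev.
  by apply: greenR_trans Lve; rewrite greenR_sym.
have [uv_nc|/centralP uv_c] := boolP (noncentral m (u * v)).
  exact: prod_central uC vu uv_nc.
have [wv_nc|/centralP wv_c] := boolP (noncentral m (w * v)).
  exact: prod_central wC vw wv_nc.
have [/and4P[_ u_nc _ /eqP cvu] /and4P[_ w_nc _ _]] := (vu, vw).
have [uN0 wN0] := (noncentral_neq0 u_nc, noncentral_neq0 w_nc).
apply: (triangle_short (a := u) (b := v) (c := w) comm_adj_irr _ vw).
  by rewrite comm_adj_sym.
rewrite /comm_adj w_nc u_nc eq_sym uNw /=; apply/eqP.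
have /andP[_ Lvu] := Hadj v u vC uC vu; have /andP[_ Lvw] := Hadj v w vC wC vw.
have wuN0 := nzd w u wN0 uN0.
(* Cancel v on the right: centrality of wv gives w u v = (w v) u = u (w v). *)
apply: (mul_injL Sz (u := v) (nzd _ _ wuN0 vN0)).
  apply: greenR_trans (greenL_mul Sz wuN0) _.
  rewrite /greenL greenR_sym in Lvu; apply: greenR_trans Lvu _; apply: greenR_trans Lvw _.
  by rewrite /greenL greenR_sym; apply: (greenL_mul Sz); apply: nzd.
by rewrite -!mA -wv_c -cvu mA.
Qed.

Lemma comm_short v : v \in C -> short_cycle (comm_adj m).
Proof.
move=> vC.
have [/exists_inP[x xC /exists_inP[y yC /andP[xy /eqP xy0]]]|noz] :=
    boolP [exists x in C, exists y in C, comm_adj m x y && (x * y == z)].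
  exact: (null_edge_short xC yC xy xy0).
apply: (group_edges_short vC) => x y xC yC xy; apply: contraNneq noz => xy0.
by apply/exists_inP; exists x => //; apply/exists_inP; exists y; rewrite // xy xy0 /=.
Qed.

End CommutingCycles.

(** Rotate the cycle to start at v: its neighbours are the second and the last entries, distinct
    because the length exceeds 2. *)
Lemma ucycle_min_degree2 (T : finType) (e : rel T) (c : seq T) :
  symmetric e -> 2 < size c -> ucycleb e c -> min_degree2 e [in c].
Proof.
move=> eS + /andP[+ + v /rot_to[i s def_s]].
rewrite -(size_rot i) -(rot_cycle i) -(rot_uniq i) def_s.
have mem_c x : x \in v :: s -> x \in c by rewrite -def_s mem_rot.
case: s def_s mem_c => [|u [|w s]] //= _ mem_c _.
rewrite rcons_path => /and4P[vu _ _ wv] /and3P[_ u_s _].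
exists u, (last w s); split=> //; last by rewrite eS.
- by apply: mem_c; rewrite !inE eqxx orbT.
- by apply: mem_c; rewrite 2!in_cons mem_last !orbT.
- by apply: contraNneq u_s => ->; apply: mem_last.
Qed.

(** * Completely 0-simple semigroups and the girth *)

Local Open Scope group_scope.

Lemma completely_zero_simple_zsimple (S : finSemigroupType) (z : S) :
  completely_zero_simple z -> zsimple (fun x y : S => x * y) z.
Proof.
move=> [Z0 [not_null simpleS] _].
have z0x x : z * x = z by case: (Z0 x).
have zx0 x : x * z = z by case: (Z0 x).
split=> //; first exact: mulgA.
move=> a x aN0; pose SaS (b : S) := [set s * b * t | s : S, t : S].
have ideal_SaS b : is_ideal (SaS b).
  split; first by apply/set0Pn; exists (z * b * z); apply/imset2P; exists z z.
  move=> _ r /imset2P[s t _ _ ->]; split; apply/imset2P.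
    by exists (r * s) t; rewrite // !mulgA.
  by exists s (t * r); rewrite // !mulgA.
have [SaS0|SaST] := simpleS _ (ideal_SaS a); last first.
  have : x \in SaS a by rewrite SaST inE.
  by case/imset2P=> s t _ _ ->; exists s, t.
(* If SaS = 0 with a nonzero, this ideal contains a and so is all of S, whence S^3 = 0. *)
pose J := [set b | SaS b == [set z]].
have ideal_J : is_ideal J.
  split=> [|b r]; first by apply/set0Pn; exists a; rewrite inE SaS0.
  rewrite !inE => /eqP SbS0.
  have b0 s t : s * b * t = z by apply/set1P; rewrite -SbS0; apply: imset2_f.
  have null c : (forall s t, s * c * t = z) -> SaS c == [set z].
    move=> c0; rewrite eqEsubset; apply/andP; split; apply/subsetP=> y.
      by case/imset2P=> s t _ _ ->; rewrite c0 inE.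
    by move/set1P=> ->; apply/imset2P; exists z z; rewrite ?c0.
  by split; apply: null => s t; [rewrite mulgA b0|rewrite -!mulgA mulgA b0].
have JT : J = [set: S].
  have [J0|//] := simpleS J ideal_J.
  have : a \in J by rewrite inE SaS0.
  by rewrite J0 inE (negPf aN0).
have all0 (s b t : S) : s * b * t = z.
  have : b \in J by rewrite JT inE.
  by rewrite inE => /eqP SbS0; apply/set1P; rewrite -SbS0; apply: imset2_f.
(* The ideal S^2 is not 0, as S is not null; if it were S, then S = S^3 = 0. *)
pose SS := [set s * t | s : S, t : S].
have [|SS0|SST] := simpleS SS.
- split=> [|_ r /imset2P[s t _ _ ->]]; first by apply/set0Pn; exists (z * z); apply: imset2_f.
  by split; rewrite ?mulgA all0 -(all0 z z z); apply: imset2_f.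
- by case: not_null => s t; apply/set1P; rewrite -SS0; apply: imset2_f.
have all_z y : y = z.
  have : y \in SS by rewrite SST inE.
  case/imset2P=> p q _ _ ->; have : p \in SS by rewrite SST inE.
  by case/imset2P=> p1 p2 _ _ ->.
by case/eqP: aN0.
Qed.

Theorem corollary9p6 (S : finSemigroupType) (z : S)
    (S_czs : completely_zero_simple z)
    (S_nc : noncommutative_semigroup S)
    (S_cyc : contains_cycles (commuting_graph S)) :
  girth S_cyc \in [:: 3; 4].
Proof.
rewrite /girth; case: ex_minnP => n /andP[n_gt2 /existsP[c uc]] n_min.
pose m (x y : S) := x * y.
have nc_center x : noncentral m x = (x \notin center S).
  by rewrite inE negb_forall.
have adjE : @adj (commuting_graph S) =2 relpre val (comm_adj m).
  by move=> x y; rewrite /= /comm_adj !nc_center (valP x) (valP y).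
have lift_cycle k : [exists d : k.-tuple S, ucycleb (comm_adj m) d] -> 2 < k ->
    has_cycle_of_length (commuting_graph S) k.
  move=> /existsP[d ud] k_gt2; rewrite /has_cycle_of_length k_gt2 /=.
  (* Each vertex of the cycle has an edge, so it is noncentral; [pmap insub] below therefore drops
     nothing. *)
  have d_nc : all (fun x => x \notin center S) d.
    apply/allP=> x x_d.
    have [|u [_ [_ _ _ /and4P[x_nc _ _ _] _]]] :=
      ucycle_min_degree2 (@comm_adj_sym S m) _ ud x_d; first by rewrite size_tuple.
    by rewrite -nc_center.
  pose d' : seq (commuting_graph S) := pmap insub d.
  have d'E : map val d' = d.
    by rewrite (pmap_filter (insubK _)); apply/all_filterP; rewrite (eq_all (isSome_insub _)).
  have sz_d' : size d' == k by rewrite -(size_map val) d'E size_tuple.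
  apply/existsP; exists (Tuple sz_d'); move: ud; rewrite -d'E.
  rewrite /ucycleb map_inj_uniq; last exact: val_inj.
  by rewrite cycle_map (eq_cycle adjE).
have : short_cycle (comm_adj m).
  have u_val : ucycleb (comm_adj m) (map val c).
    have /andP[cyc_c uniq_c] := uc.
    rewrite /ucycleb map_inj_uniq ?uniq_c ?andbT; last exact: val_inj.
    by rewrite cycle_map -(eq_cycle adjE).
  have sz : 2 < size (map val c) by rewrite size_map size_tuple.
  have /hasP[v vc _] : has predT (map val c) by rewrite has_predT (ltn_trans _ sz).
  apply: (comm_short (completely_zero_simple_zsimple S_czs) _ vc).
  exact: (ucycle_min_degree2 (@comm_adj_sym S m) sz u_val).
(* Minimality bounds n by 3 or by 4, and n > 2 leaves only these two values. *)
case/orP=> /lift_cycle has_k; have := n_min _ (has_k isT);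
  by move: n_gt2; case: n => [|[|[|[|[|n]]]]] in c uc n_min *.
Qed.
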